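(* Let $\alpha>2$ and let $K^\alpha$ be the Cantor set defined in the context. Then $K^\alpha\notin\mathcal{BLC}$; that is, there is no family $(X_N)_{N\ge1}$, where each $X_N$ is a set of $N$ distinct points of $K^\alpha$, such that the sequence $(\Lambda_N(X_N,K^\alpha))_{N=1}^\infty$ is bounded.
   Context: Geometrically symmetric Cantor sets: let $(\ell_s)_{s\ge 0}$ be a sequence of positive numbers with $\ell_0=1$ and $3\ell_{s+1}\le \ell_s$ for all $s\ge 0$. Put $E_0=I_{1,0}=[0,1]$; given $E_s=\bigcup_{j=1}^{2^s} I_{j,s}$, a disjoint union of closed intervals of length $\ell_s$ (numbered from left to right), $E_{s+1}$ is obtained by replacing each $I_{j,s}$ by two closed subintervals $I_{2j-1,s+1}$ and $I_{2j,s+1}$ of length $\ell_{s+1}$, the first sharing the left endpoint and the second the right endpoint of $I_{j,s}$. The associated Cantor set is $K=\bigcap_{s\ge0}E_s$. The set $K^\alpha$ ($\alpha>1$) is the Cantor set associated with $\ell_0=1$, $\ell_s=\ell_1^{\alpha^{s-1}}$ for $s\ge1$, where $\ell_1>0$ is a fixed number with $\ell_1\le 1/3$ and $\ell_1^{\alpha-1}\le 1/3$ (equivalently $\alpha\ge(\log\ell_1-\log 3)/\log\ell_1$). Lebesgue constant: for a set $Z=\{x_1,\dots,x_N\}$ of $N$ distinct points of a compact set $K\subset\mathbb R$, let $l_k(x)=\prod_{i\ne k}\frac{x-x_i}{x_k-x_i}$ ($1\le k\le N$) and $\Lambda_N(Z,K)=\sup_{x\in K}\sum_{k=1}^N|l_k(x)|$.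 A compact set $K\subset\mathbb R$ belongs to the class $\mathcal{BLC}$ (bounded Lebesgue constants) if there is an array $(X_N)_{N\ge 1}$, with $X_N$ consisting of $N$ distinct points of $K$, such that $(\Lambda_N(X_N,K))_{N=1}^\infty$ is bounded. *)

(* Defs.v *)
From HB Require Import structures.
From mathcomp Require Import all_boot all_order all_algebra.
From mathcomp Require Import all_classical all_reals all_analysis.

Set Implicit Arguments.
Unset Strict Implicit.
Unset Printing Implicit Defensive.

Import Order.TTheory GRing.Theory Num.Theory.
Import numFieldNormedType.Exports.

Local Open Scope classical_set_scope.
Local Open Scope ring_scope.

(* Left endpoint of the j-th interval of level s.  Intervals are numbered from
   0 (so j < 2 ^ s, left to right): the children of the interval j are 2 * j,
   which shares its left endpoint, and 2 * j + 1, which shares its right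
   endpoint. *)
Fixpoint cantor_left (R : realType) (ell : nat -> R) (s j : nat) : R :=
  if s is s'.+1 then
    cantor_left ell s' j./2 + (if odd j then ell s' - ell s'.+1 else 0)
  else 0.

Definition cantor_interval (R : realType) (ell : nat -> R) (s j : nat) : set R :=
  `[cantor_left ell s j, cantor_left ell s j + ell s].

Definition cantor_level (R : realType) (ell : nat -> R) (s : nat) : set R :=
  \bigcup_(j in [set j | (j < 2 ^ s)%N]) cantor_interval ell s j.

Definition cantor_set (R : realType) (ell : nat -> R) : set R :=
  \bigcap_(s in [set: nat]) cantor_level ell s.

Definition ell_alpha (R : realType) (alpha ell1 : R) (s : nat) : R :=
  if s is s'.+1 then ell1 `^ (alpha ^+ s') else 1.

Definition K_alpha (R : realType) (alpha ell1 : R) : set R :=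
  cantor_set (ell_alpha alpha ell1).

Definition lagrange_basis (R : realType) (N : nat) (z : 'I_N -> R) (k : 'I_N)
    (x : R) : R :=
  \prod_(i < N | i != k) ((x - z i) / (z k - z i)).

(* The supremum is taken in the extended reals, so that it is the true supremum
   with no boundedness side condition. *)
Definition lebesgue_constant (R : realType) (N : nat) (z : 'I_N -> R)
    (K : set R) : \bar R :=
  ereal_sup [set (\sum_(k < N) `|lagrange_basis z k x|)%:E | x in K].

(* The class is meant for compact K.  Compactness is not part of the predicate,
   so that its negation asserts exactly that no array with bounded Lebesgue
   constants exists. *)
Definition BLC (R : realType) (K : set R) : Prop :=
  exists X : forall N : nat, 'I_N -> R,
    (forall N : nat, (1 <= N)%N ->
       injective (X N) /\ (forall k : 'I_N, K (X N k))) /\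
    (exists M : R, forall N : nat, (1 <= N)%N ->
       (lebesgue_constant (X N) K <= M%:E)%E).

(* Main.v *)
(* Take N = 2^s - 1 nodes and count them in the intervals of each level j <= s.
   If two sibling intervals of level j hold fewer, respectively more, than
   2^(s-j) nodes, follow sparse children down to a point x whose interval of
   level s is free of nodes, and dense children down to a node a sharing its
   interval with another node.  Comparing node by node the distances to x and to
   a, up to a factor 3 each, |l_a(x)| is at least 3^-N ell_{s-1} / ell_s, which
   for alpha > 2 beats every bound because alpha^s grows faster than 2^s.
   Otherwise every interval of level j <= s holds exactly 2^(s-j) nodes, one
   fewer along the single branch leading to an empty interval.  For x in that
   empty interval and any node a in the interval of level s - m around x, the
   two families of distances then match up to a factor
   1 - O(ell_{s-m} / ell_{s-m-1}) each, so |l_a(x)| tends to at least 1 as s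
   grows with m fixed; as there are 2^m - 1 such nodes, the Lebesgue constant is
   at least of order 2^m. *)
Require Import Defs.
From mathcomp Require Import all_boot all_order all_algebra.
From mathcomp Require Import all_classical all_reals all_analysis.
From mathcomp Require Import zify ring lra.

Import Order.TTheory GRing.Theory Num.Theory.

Local Open Scope ring_scope.

(** * Addresses of points of the Cantor set, and distances read off from them *)

Section CantorGeometry.
Set Implicit Arguments.
Unset Strict Implicit.

Context {R : realType} (ell : nat -> R).
Hypothesis ell0 : ell 0 = 1.
Hypothesis ell_gt0 : forall s, 0 < ell s.
Hypothesis ell_le : forall s, 3 * ell s.+1 <= ell s.

Local Notation K := (cantor_set ell).
Local Notation left := (cantor_left ell).

Lemma cantor_left_lt s j k : (k < 2 ^ s)%N -> (j < k)%N ->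
  left s j + ell s < left s k.
Proof.
elim: s j k => [|s IHs] j k; first by rewrite expn0; lia.
move=> ks jk /=; have := ell_gt0 s.+1; have := ell_le s.
have [jk2|jk2] := leqP k./2 j./2.
  have -> : j./2 = k./2 by lia.
  have -> : odd j = false by lia.
  have -> : odd k = true by lia.
  by lra.
have /IHs/(_ jk2) : (k./2 < 2 ^ s)%N by rewrite expnS in ks; lia.
by case: (odd j); case: (odd k); lra.
Qed.

Lemma cantor_interval_child s j :
  (cantor_interval ell s.+1 j `<=` cantor_interval ell s j./2)%classic.
Proof.
move=> y; rewrite /cantor_interval /= !in_itv /=.
have := ell_gt0 s.+1; have := ell_le s.
by case: (odd j) => ? ? /andP[? ?]; apply/andP; split; lra.
Qed.

Lemma cantor_interval_inj s j k y : (j < 2 ^ s)%N -> (k < 2 ^ s)%N ->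
  cantor_interval ell s j y -> cantor_interval ell s k y -> j = k.
Proof.
move=> js ks; rewrite /cantor_interval /= !in_itv /= => /andP[? ?] /andP[? ?].
have [jk|kj|//] := ssrnat.ltngtP j k.
  exfalso; by have := cantor_left_lt ks jk; lra.
exfalso; by have := cantor_left_lt js kj; lra.
Qed.

(** The choice is unambiguous because the intervals of one level are disjoint; the default 0 occurs
    only for [y] outside level [s]. *)
Definition cantor_pos (y : R) (s : nat) : nat :=
  xget 0%N [set j | (j < 2 ^ s)%N /\ cantor_interval ell s j y]%classic.

Local Notation pos := cantor_pos.

Lemma cantor_posP y s : K y ->
  (pos y s < 2 ^ s)%N /\ cantor_interval ell s (pos y s) y.
Proof.
move=> Ky; have [j /= js yj] := Ky s I.
by apply: (@xgetPex _ 0%N [set i | (i < 2 ^ s)%N /\ cantor_interval ell s i y]%classic); exists j.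
Qed.

Lemma cantor_pos_eq y s j : K y -> (j < 2 ^ s)%N ->
  cantor_interval ell s j y -> pos y s = j.
Proof.
move=> Ky js yj; have [ps yp] := cantor_posP s Ky.
exact: cantor_interval_inj yp yj.
Qed.

Lemma cantor_pos_half y s : K y -> (pos y s.+1)./2 = pos y s.
Proof.
move=> Ky; have [ps yp] := cantor_posP s.+1 Ky.
apply/esym/cantor_pos_eq => //; last exact: cantor_interval_child.
by rewrite expnS in ps; lia.
Qed.

Lemma cantor_pos_eq_le x y s t : K x -> K y -> (s <= t)%N ->
  pos x t = pos y t -> pos x s = pos y s.
Proof.
move=> Kx Ky /subnK <-; elim: (t - s)%N => // n IHn xy; apply: IHn.
by rewrite -(cantor_pos_half _ Kx) -(cantor_pos_half _ Ky) -addSn xy.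
Qed.

(** Even children keep the left endpoint, so it survives at all deeper levels; nesting of the
    intervals gives the shallower ones. *)
Lemma cantor_pos_left s j : (j < 2 ^ s)%N -> K (left s j) /\ pos (left s j) s = j.
Proof.
move=> js; have Il : forall t k, cantor_interval ell t k (left t k).
  by move=> t k; rewrite /cantor_interval /= in_itv /= lexx lerDl ltW.
suff Kl : K (left s j) by split=> //; apply: cantor_pos_eq.
have up n : exists2 k, (k < 2 ^ (n + s))%N & left (n + s) k = left s j.
  elim: n => [|n [k kn kE]]; first by exists j.
  exists k.*2; first by rewrite addSn expnS; lia.
  by rewrite addSn /= odd_double doubleK addr0.
have down n t k y : (k < 2 ^ (n + t))%N -> cantor_interval ell (n + t) k y ->
    cantor_level ell t y.
  elim: n k => [|n IHn] k; first by exists k.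
  rewrite addSn => kn /cantor_interval_child; apply: IHn.
  by rewrite expnS in kn; lia.
(* Climbing [t] levels from [s] and descending [s] levels ends at level [t], without comparing [s]
   and [t]. *)
move=> t _; have [k kn kE] := up t.
by apply: (down s t k); rewrite addnC // -kE.
Qed.

Lemma cantor_pos_dist_le x y s : K x -> K y -> pos x s = pos y s ->
  `|x - y| <= ell s.
Proof.
move=> /(cantor_posP s)[_ +] /(cantor_posP s)[_ +] xy.
rewrite /cantor_interval /= !in_itv xy /= => /andP[? ?] /andP[? ?].
by rewrite ler_norml; apply/andP; split; lra.
Qed.

(** The bound is the width of the gap between two sibling intervals. *)
Lemma cantor_pos_dist_ge x y s : K x -> K y -> pos x s = pos y s ->
  pos x s.+1 <> pos y s.+1 -> ell s - 2 * ell s.+1 <= `|x - y|.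
Proof.
move=> Kx Ky; rewrite -(cantor_pos_half _ Kx) -(cantor_pos_half _ Ky).
move: Kx Ky => /(cantor_posP s.+1)[_ +] /(cantor_posP s.+1)[_ +].
move: (pos x s.+1) (pos y s.+1) => i j.
rewrite /cantor_interval /= !in_itv /= => + + ij; rewrite ij => xi yj ij_neq.
have : odd i <> odd j by lia.
move: xi yj; case: (odd i) (odd j) => [] [] // /andP[? ?] /andP[? ?] _.
  by rewrite ler_normr; apply/orP; left; lra.
by rewrite ler_normr; apply/orP; right; lra.
Qed.

Lemma cantor_pos_split x y s : K x -> K y -> pos x s <> pos y s ->
  exists2 t, (t < s)%N & pos x t = pos y t /\ pos x t.+1 <> pos y t.+1.
Proof.
move=> Kx Ky; elim: s => [|s IHs].
  by have [] := cantor_posP 0 Kx; have [] := cantor_posP 0 Ky; rewrite expn0; lia.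
have [xy|/IHs[t ts tP]] := EM (pos x s = pos y s); first by exists s.
by move=> _; exists t => //; lia.
Qed.

(** * Comparison of the distance with an ultrametric *)

Definition cantor_ratio s : R := ell s.+1 / ell s.

Local Notation r := cantor_ratio.

Lemma cantor_ratio_gt0 s : 0 < r s.
Proof. by rewrite divr_gt0. Qed.

Lemma cantor_ratio_le s : r s <= 3^-1.
Proof. by rewrite ler_pdivrMr //; have := ell_le s; lra. Qed.

Lemma ell_ratioS s : ell s.+1 = ell s * r s.
Proof. by rewrite mulrC divfK // gt_eqF. Qed.

(* An ultrametric proxy for the distance: [ell t] for the last level [t <= T]
   at which [x] and [y] lie in the same interval. *)
Definition cantor_dist T (x y : R) : R :=
  \prod_(j < T) (if pos x j.+1 == pos y j.+1 then r j else 1).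

Local Notation dist := cantor_dist.

Lemma cantor_distS T x y :
  dist T.+1 x y = dist T x y * (if pos x T.+1 == pos y T.+1 then r T else 1).
Proof. exact: big_ord_recr. Qed.

Lemma cantor_dist_gt0 T x y : 0 < dist T x y.
Proof.
by apply: prodr_gt0 => j _; case: ifP => // _; exact: cantor_ratio_gt0.
Qed.

Lemma cantor_dist_same T x y : K x -> K y -> pos x T = pos y T ->
  dist T x y = ell T.
Proof.
move=> Kx Ky; elim: T => [|T IHT] xy; first by rewrite /dist big_ord0 ell0.
rewrite cantor_distS xy eqxx IHT ?ell_ratioS //.
exact: cantor_pos_eq_le xy.
Qed.

Lemma cantor_dist_split T t x y : K x -> K y -> (t < T)%N ->
  pos x t = pos y t -> pos x t.+1 <> pos y t.+1 -> dist T x y = ell t.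
Proof.
move=> Kx Ky + xy nxy; elim: T => // T IHT; rewrite ltnS leq_eqVlt => /orP[/eqP <-|tT].
  by rewrite cantor_distS cantor_dist_same // (introF eqP nxy) mulr1.
rewrite cantor_distS IHT // ifF ?mulr1 //; apply/eqP => xyT; apply: nxy.
by apply: cantor_pos_eq_le xyT => //; lia.
Qed.

Lemma cantor_dist_ge T x y : K x -> K y -> `|x - y| <= dist T x y.
Proof.
move=> Kx Ky; have [xy|/cantor_pos_split[//|//|t tT [xy nxy]]] :=
    EM (pos x T = pos y T).
  by rewrite cantor_dist_same // cantor_pos_dist_le.
by rewrite (cantor_dist_split (t := t)) // cantor_pos_dist_le.
Qed.

(** The points part after some level [t >= u], and the gap there is [ell t - 2 * ell t.+1 = (1 - 2 *
    r t) * ell t]. *)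
Lemma cantor_dist_le T u eps x y : K x -> K y -> pos x u = pos y u ->
  pos x T <> pos y T -> (forall j, (u <= j)%N -> r j <= eps) ->
  (1 - 2 * eps) * dist T x y <= `|x - y|.
Proof.
move=> Kx Ky xyu /cantor_pos_split[//|//|t tT [xy nxy]] r_le.
rewrite (cantor_dist_split (t := t)) //.
apply: le_trans (cantor_pos_dist_ge Kx Ky xy nxy).
have /r_le : (u <= t)%N.
  by rewrite leqNgt; apply/negP => tu; apply: nxy; apply: cantor_pos_eq_le xyu.
by have := ell_gt0 t; rewrite ell_ratioS; nra.
Qed.

Lemma cantor_dist_le3 T x y : K x -> K y -> pos x T <> pos y T ->
  3^-1 * dist T x y <= `|x - y|.
Proof.
move=> Kx Ky xy.
have xy0 : pos x 0 = pos y 0.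
  by have [] := cantor_posP 0 Kx; have [] := cantor_posP 0 Ky; rewrite expn0; lia.
have := cantor_dist_le Kx Ky xy0 xy (fun j _ => cantor_ratio_le j).
by apply: le_trans; rewrite ler_pM2r ?cantor_dist_gt0 //; lra.
Qed.

Lemma ell_decreasing s t : (s <= t)%N -> ell t <= ell s.
Proof.
move=> /subnK <-; elim: (t - s)%N => // n IHn; apply: le_trans IHn.
by rewrite addSn; have := ell_le (n + s); have := ell_gt0 (n + s).+1; lra.
Qed.

Lemma cantor_far_ge u x y : K x -> K y -> pos x u.+1 <> pos y u.+1 ->
  ell u <= 3 * `|x - y|.
Proof.
move=> Kx Ky xy; have := cantor_dist_le3 Kx Ky xy.
have [t tu [xyt nxyt]] := cantor_pos_split Kx Ky xy.
rewrite (cantor_dist_split (t := t)) //.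
have : ell u <= ell t by apply: ell_decreasing; lia.
by lra.
Qed.

(** * Counting nodes in intervals *)

Section Nodes.
Context {N : nat} (z : 'I_N -> R).
Hypothesis Kz : forall i, K (z i).
Hypothesis z_inj : injective z.

Definition node_count j p : nat := #|[pred i | pos (z i) j == p]|.

Local Notation cnt := node_count.

Lemma node_count_split j p : cnt j p = (cnt j.+1 p.*2 + cnt j.+1 p.*2.+1)%N.
Proof.
rewrite /cnt -(cardID [pred i | odd (pos (z i) j.+1)] [pred i | pos (z i) j == p]).
rewrite addnC.
congr (_ + _)%N; apply: eq_card => i; rewrite !inE -(cantor_pos_half j (Kz i)).
  by lia.
by lia.
Qed.

Lemma node_count0 : cnt 0 0 = N.
Proof.
rewrite -[RHS]card_ord; apply: eq_card => i; rewrite !inE.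
by have [+ _] := cantor_posP 0 (Kz i); rewrite expn0; lia.
Qed.

(** Pigeonhole: one child always holds less than half of the strict bound. At level [k + d] the
    bound is 1, so the last interval is free of nodes. *)
Lemma sparse_descent d k p : (p < 2 ^ k)%N -> (cnt k p < 2 ^ d)%N ->
  exists y, [/\ K y, pos y k = p &
    forall j, (k <= j <= k + d)%N -> (cnt j (pos y j) < 2 ^ (k + d - j))%N].
Proof.
elim: d k p => [|d IHd] k p pk cp.
  have [Ky yp] := cantor_pos_left pk; exists (left k p); split=> // j kj.
  have -> : j = k by lia.
  by rewrite yp addn0 subnn.
have [q [qk qp cq]] : exists q, [/\ (q < 2 ^ k.+1)%N, q./2 = p & (cnt k.+1 q < 2 ^ d)%N].
  rewrite node_count_split expnS in cp; rewrite expnS.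
  have [c0|c0] := ltnP (cnt k.+1 p.*2) (2 ^ d).
    by exists p.*2; split=> //; lia.
  by exists p.*2.+1; split=> //; lia.
have [y [Ky yq cy]] := IHd _ _ qk cq; exists y.
have yp : pos y k = p by rewrite -(cantor_pos_half k Ky) yq.
split=> // j; rewrite leq_eqVlt => /andP[/orP[/eqP <-|kj] jd].
  by rewrite yp addnC addnK.
by rewrite -addSnnS cy // kj; lia.
Qed.

(** The mirror image of [sparse_descent]: at level [k + d] more than one node is left, so [z a]
    shares its interval with another node. *)
Lemma dense_descent d k p : (2 ^ d < cnt k p)%N ->
  exists a, pos (z a) k = p /\
    forall j, (k <= j <= k + d)%N -> (2 ^ (k + d - j) < cnt j (pos (z a) j))%N.
Proof.
elim: d k p => [|d IHd] k p cp.
  have /card_gt0P[a /eqP ap] : (0 < cnt k p)%N by lia.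
  exists a; split=> // j kj; have -> : j = k by lia.
  by rewrite ap addn0 subnn.
have [q [qp cq]] : exists q, q./2 = p /\ (2 ^ d < cnt k.+1 q)%N.
  move: cp; rewrite node_count_split expnS => cp.
  have [c0|c0] := ltnP (2 ^ d) (cnt k.+1 p.*2).
    by exists p.*2; split=> //; lia.
  by exists p.*2.+1; split=> //; lia.
have [a [aq ca]] := IHd _ _ cq; exists a.
have ap : pos (z a) k = p by rewrite -(cantor_pos_half k (Kz a)) aq.
split=> // j; rewrite leq_eqVlt => /andP[/orP[/eqP <-|kj] jd].
  by rewrite ap addnC addnK.
by rewrite -addSnnS ca // kj; lia.
Qed.

(** * Lower bounds for a Lagrange basis function *)

(** Exchanging the products over nodes and levels, level [j] contributes one factor [r j] per node
    in the interval of [y]; the subtracted term discounts [z a] itself. *)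
Lemma prod_cantor_dist T a y : \prod_(i < N | i != a) dist T y (z i) =
  \prod_(j < T) r j ^+ (cnt j.+1 (pos y j.+1) - (pos (z a) j.+1 == pos y j.+1)).
Proof.
rewrite exchange_big; apply: eq_bigr => j _.
rewrite -big_mkcondr /= prodr_const; congr (_ ^+ _).
rewrite /cnt [X in (X - _)%N](cardD1 a) inE addKn; apply: eq_card => i.
rewrite !inE.
by congr (_ && _); rewrite eq_sym.
Qed.

Lemma cantor_ratio_exp_le j m n : (m <= n)%N -> r j ^+ n <= r j ^+ m.
Proof.
have := cantor_ratio_gt0 j; have := cantor_ratio_le j => ? ?.
by apply: ler_wiXn2l; lra.
Qed.

Lemma lagrange_basis_ge T x a c : K x -> 0 <= c ->
  (forall i, i != a ->
     c * (dist T x (z i) / dist T (z a) (z i)) <= `|x - z i| / `|z a - z i|) ->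
  c ^+ N.-1 * (\prod_(i < N | i != a) dist T x (z i) /
               \prod_(i < N | i != a) dist T (z a) (z i))
    <= `|lagrange_basis z a x|.
Proof.
move=> Kx c0 cle; rewrite /lagrange_basis normr_prod -prodf_div.
have -> : c ^+ N.-1 = \prod_(i < N | i != a) c.
  by rewrite prodr_const cardC1 card_ord.
rewrite -big_split /=; apply: ler_prod => i ia.
by rewrite normrM normfV cle // mulr_ge0 // divr_ge0 ?ltW ?cantor_dist_gt0.
Qed.

Lemma node_dist_gt0 a i : i != a -> 0 < `|z a - z i|.
Proof. by move=> ia; rewrite normr_gt0 subr_eq0 eq_sym (inj_eq z_inj). Qed.

(* Each count, with the node [z a] left out, is at most as large around [x] as
   around [z a], and strictly smaller at the last level, which contributes
   the factor [(r s)^-1]. *)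
Lemma lagrange_basis_ge_unbalanced s x a : K x ->
  cnt s.+1 (pos x s.+1) = 0%N ->
  (1 < cnt s.+1 (pos (z a) s.+1))%N ->
  (forall j, (j <= s)%N ->
     cnt j.+1 (pos x j.+1) + (pos (z a) j.+1 != pos x j.+1)
       <= cnt j.+1 (pos (z a) j.+1))%N ->
  3^-1 ^+ N.-1 / r s <= `|lagrange_basis z a x|.
Proof.
move=> Kx x0 a1 le_cnt; have x_neq i : pos x s.+1 <> pos (z i) s.+1.
  move=> xi; have : (0 < cnt s.+1 (pos x s.+1))%N.
    by apply/card_gt0P; exists i; rewrite inE xi.
  by rewrite x0.
have third0 : 0 <= 3^-1 :> R by lra.
have /(lagrange_basis_ge Kx third0) : forall i, i != a ->
    3^-1 * (dist s.+1 x (z i) / dist s.+1 (z a) (z i)) <=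
    `|x - z i| / `|z a - z i|.
  (* The factor 1/3 is lost in the numerator only; in the denominator the proxy is an upper bound as
     it stands. *)
  move=> i ia; rewrite mulrA; apply: ler_pM.
  - by rewrite mulr_ge0 // ltW // cantor_dist_gt0.
  - by rewrite invr_ge0 ltW // cantor_dist_gt0.
  - exact: cantor_dist_le3.
  - by rewrite lef_pV2 ?cantor_dist_ge ?posrE ?cantor_dist_gt0 ?node_dist_gt0.
apply: le_trans.
rewrite ler_pM2l ?exprn_gt0 ?invr_gt0 //.
rewrite ler_pdivlMr; last by apply: prodr_gt0 => i _; exact: cantor_dist_gt0.
rewrite mulrC ler_pdivrMr ?cantor_ratio_gt0 // !prod_cantor_dist.
rewrite !big_ord_recr /= eqxx x0 sub0n expr0 mulr1.
apply: ler_pM; rewrite ?exprn_ge0 ?(ltW (cantor_ratio_gt0 _)) //.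
- by apply: prodr_ge0 => j _; rewrite exprn_ge0 // ltW // cantor_ratio_gt0.
- apply: ler_prod => j _; rewrite exprn_ge0 ?(ltW (cantor_ratio_gt0 _)) //=.
  apply: cantor_ratio_exp_le; have := le_cnt j (ltnW (ltn_ord j)).
  by rewrite eqxx; case: eqP; lia.
- by rewrite -[leRHS]expr1; apply: cantor_ratio_exp_le; lia.
Qed.

(** Completing the nodes by [x] makes all counts of a level equal. Hence the two products of proxies
    cancel exactly, and only the distortion at each node remains. *)
Lemma lagrange_basis_ge_balanced s u eps x a : K x -> (u < s)%N ->
  (forall j p, (0 < j <= s)%N -> (p < 2 ^ j)%N ->
     cnt j p + (p == pos x j) = 2 ^ (s - j))%N ->
  eps <= 3^-1 -> (forall j, (u <= j)%N -> r j <= eps) ->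
  pos (z a) u.+1 = pos x u.+1 ->
  (1 - 3 * eps) ^+ N.-1 <= `|lagrange_basis z a x|.
Proof.
move=> Kx us cntE eps3 r_le ax.
have pos_lt j y : K y -> (pos y j < 2 ^ j)%N by move=> /(cantor_posP j)[].
have x_neq i : pos x s <> pos (z i) s.
  move=> xi; have : (0 < cnt s (pos x s))%N.
    by apply/card_gt0P; exists i; rewrite inE xi.
  have s0 : (0 < s <= s)%N by lia.
  by have := cntE s _ s0 (pos_lt s x Kx); rewrite eqxx subnn; lia.
have c0 : 0 <= 1 - 3 * eps by lra.
have := @lagrange_basis_ge s x a _ Kx c0.
rewrite !prod_cantor_dist.
have -> : \prod_(j < s)
    r j ^+ (cnt j.+1 (pos x j.+1) - (pos (z a) j.+1 == pos x j.+1)) =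
  \prod_(j < s)
    r j ^+ (cnt j.+1 (pos (z a) j.+1) - (pos (z a) j.+1 == pos (z a) j.+1)).
  apply: eq_bigr => j _; congr (_ ^+ _).
  have js : (0 < j.+1 <= s)%N by rewrite /=.
  have := cntE _ _ js (pos_lt j.+1 x Kx); have := cntE _ _ js (pos_lt j.+1 _ (Kz a)).
  by rewrite !eqxx; case: eqP => [->|]; lia.
rewrite divff ?mulr1; last first.
  apply/lt0r_neq0/prodr_gt0 => j _; rewrite exprn_gt0 //; exact: cantor_ratio_gt0.
apply=> i ia; have eps0 : 0 < eps.
  by apply: lt_le_trans (r_le u _) => //; exact: cantor_ratio_gt0.
have dza := node_dist_gt0 ia.
have dx := cantor_dist_gt0 s x (z i); have da := cantor_dist_gt0 s (z a) (z i).
(* A node in the common interval of level [u.+1] parts from [x] at a level beyond [u], where the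
   proxy loses at most [1 - 2 * eps]. *)
have [xi|xi] := EM (pos x u.+1 = pos (z i) u.+1).
  rewrite mulrA; apply: ler_pM.
  - by rewrite mulr_ge0 // ltW.
  - by rewrite invr_ge0 ltW.
  - have := cantor_dist_le Kx (Kz i) xi (x_neq i) (fun j uj => r_le j (ltnW uj)).
    by apply: le_trans; rewrite ler_pM2r //; lra.
  - by rewrite lef_pV2 ?posrE //; exact: cantor_dist_ge.
(* A node outside that interval branches off from [x] and [z a] at the same level. The true
   distances then differ by at most [ell u.+1], which is at most [3 * eps] times the distance to
   [z a]. *)
have -> : dist s x (z i) = dist s (z a) (z i).
  have [t tu [xt nxt]] := cantor_pos_split Kx (Kz i) xi.
  have at1 : pos (z a) t.+1 = pos x t.+1 by apply: cantor_pos_eq_le ax.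
  have at0 : pos (z a) t = pos x t by apply: cantor_pos_eq_le at1.
  by rewrite !(@cantor_dist_split s t) ?at0 ?at1 //; lia.
rewrite divff ?lt0r_neq0 // mulr1 ler_pdivlMr //.
have axi : pos (z a) u.+1 <> pos (z i) u.+1 by rewrite ax.
have far := cantor_far_ge (Kz a) (Kz i) axi.
have near := cantor_pos_dist_le (Kz a) Kx ax.
have tri : `|z a - z i| <= `|z a - x| + `|x - z i| by exact: ler_distD.
have ru := r_le u (leqnn u); have lu := ell_gt0 u.
have : ell u.+1 <= 3 * eps * `|z a - z i|.
  by rewrite ell_ratioS; nra.
by lra.
Qed.

(** * Skewed versus balanced node sets *)

(** Counting [x] as an extra node, each parent holds twice the quota of a child. Away from [x], an
    uneven split would be skew; around [x], its child is below quota by assumption, so its sibling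
    can neither exceed nor miss the quota. *)
Lemma balanced_counts s x : K x -> N = (2 ^ s).-1 ->
  (forall j, (j <= s)%N -> cnt j (pos x j) < 2 ^ (s - j))%N ->
  (forall j p q, (j < s)%N -> p./2 = q./2 -> (p < 2 ^ j.+1)%N ->
     (q < 2 ^ j.+1)%N -> (2 ^ (s - j.+1) < cnt j.+1 p)%N ->
     (2 ^ (s - j.+1) <= cnt j.+1 q)%N) ->
  forall j p, (j <= s)%N -> (p < 2 ^ j)%N ->
    (cnt j p + (p == pos x j) = 2 ^ (s - j))%N.
Proof.
move=> Kx NE cntx noskew; elim=> [|j IHj] p js pj.
  have -> : p = 0%N by move: pj; rewrite expn0; lia.
  have [x0 _] := cantor_posP 0 Kx.
  have -> : pos x 0 = 0%N by move: x0; rewrite expn0; lia.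
  by rewrite node_count0 NE subn0 /= addn1 prednK // expn_gt0.
have hj : (p./2 < 2 ^ j)%N by rewrite expnS in pj; lia.
have IH := IHj _ (ltnW js) hj; rewrite node_count_split in IH.
have cx := cntx _ js; have xE := cantor_pos_half j Kx.
have ME : (2 ^ (s - j) = 2 * 2 ^ (s - j.+1))%N.
  by rewrite -expnS; congr (_ ^ _)%N; lia.
have q0 : (p./2.*2 < 2 ^ j.+1)%N by rewrite expnS; lia.
have q1 : (p./2.*2.+1 < 2 ^ j.+1)%N by rewrite expnS; lia.
have qq : p./2.*2./2 = p./2.*2.+1./2 by lia.
have := noskew j _ _ js qq q0 q1; have := noskew j _ _ js (esym qq) q1 q0.
move: (2 ^ (s - j.+1))%N ME cx IH => M -> cx IH skew skew'.
have [[pE cp]|[pE cp]] : p = p./2.*2 /\ cnt j.+1 p = cnt j.+1 p./2.*2 \/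
    p = p./2.*2.+1 /\ cnt j.+1 p = cnt j.+1 p./2.*2.+1.
- have [pE|pE] : p = p./2.*2 \/ p = p./2.*2.+1 by lia.
    by left; split=> //; congr (cnt _ _).
  by right; split=> //; congr (cnt _ _).
- rewrite cp; have [hx|hx] := eqVneq p./2 (pos x j); last by lia.
  have [xp|xp] : pos x j.+1 = p./2.*2 \/ pos x j.+1 = p./2.*2.+1 by lia.
    by rewrite xp in cx *; lia.
  by rewrite xp in cx *; lia.
- rewrite cp; have [hx|hx] := eqVneq p./2 (pos x j); last by lia.
  have [xp|xp] : pos x j.+1 = p./2.*2 \/ pos x j.+1 = p./2.*2.+1 by lia.
    by rewrite xp in cx *; lia.
  by rewrite xp in cx *; lia.
Qed.

Lemma lebesgue_function_ge s u eps : N = (2 ^ s.+1).-1 -> (u <= s)%N ->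
  eps <= 3^-1 -> (forall j, (u <= j)%N -> r j <= eps) ->
  exists2 x, K x &
    3^-1 ^+ N.-1 / r s <= \sum_(k < N) `|lagrange_basis z k x| \/
    (2 ^ (s - u)).-1%:R * (1 - 3 * eps) ^+ N.-1
      <= \sum_(k < N) `|lagrange_basis z k x|.
Proof.
move=> NE us eps3 r_le.
have [[j [p [q [js pq pj qj [cp cq]]]]]|noskew] := EM (exists j p q,
    [/\ (j <= s)%N, p./2 = q./2, (p < 2 ^ j.+1)%N, (q < 2 ^ j.+1)%N &
        (2 ^ (s - j) < cnt j.+1 p)%N /\ (cnt j.+1 q < 2 ^ (s - j))%N]).
- have [a [ap ca]] := dense_descent cp.
  have [x [Kx xq cx]] := sparse_descent qj cq.
  (* Both descents start at level [j.+1] and end at level [s.+1]. *)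
  have jsE : (j.+1 + (s - j) = s.+1)%N by lia.
  rewrite jsE in ca cx; exists x => //; left.
  have top : (j.+1 <= s.+1 <= s.+1)%N by rewrite ltnS js leqnn.
  have := cx _ top; have := ca _ top; rewrite subnn => ca1 cx1.
  have xaj : pos (z a) j = pos x j.
    by rewrite -(cantor_pos_half _ Kx) -(cantor_pos_half _ (Kz a)) ap xq.
  apply: (@le_trans _ _ `|lagrange_basis z a x|); last first.
    by rewrite (bigD1 a) //= lerDl sumr_ge0.
  apply: lagrange_basis_ge_unbalanced => //; first by lia.
  move=> i is_; have [ij|ji] := ltnP i j.
    (* Up to level [j] both points lie in the same intervals. Below it the two counts lie strictly
       on either side of a power of 2, so they differ by at least 2. *)
    have -> : pos (z a) i.+1 = pos x i.+1 by exact: cantor_pos_eq_le xaj.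
    by rewrite eqxx addn0.
  have ii : (j.+1 <= i.+1 <= s.+1)%N by lia.
  have := ca _ ii; have := cx _ ii; by case: eqP; lia.
(* Without skew siblings, the sparse descent from the root finds the empty interval. *)
have N0 : (cnt 0 0 < 2 ^ s.+1)%N.
  by rewrite node_count0 NE prednK // expn_gt0.
have [x [Kx _ cx]] := sparse_descent (expn_gt0 2 0) N0.
exists x => //; right.
have cntE : forall j p, (j <= s.+1)%N -> (p < 2 ^ j)%N ->
    (cnt j p + (p == pos x j) = 2 ^ (s.+1 - j))%N.
  apply: balanced_counts => // j p q js pq pj qj cp.
  rewrite leqNgt; apply/negP => cq; apply: noskew.
  by exists j, p, q; split.
have block : cnt u.+1 (pos x u.+1) = (2 ^ (s - u)).-1.
  have [xu _] := cantor_posP u.+1 Kx.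
  have u1 : (u < s.+1)%N by rewrite ltnS.
  by have := cntE _ _ u1 xu; rewrite eqxx subSS; lia.
rewrite -block /cnt mulr_natl -sumr_const.
rewrite [leRHS](bigID [pred i | pos (z i) u.+1 == pos x u.+1]) /= -[leLHS]addr0.
apply: lerD; last by apply: sumr_ge0.
apply: ler_sum => a /eqP ax.
apply: (@lagrange_basis_ge_balanced s.+1 u eps) => //.
by move=> j p /andP[_ js]; exact: cntE.
Qed.

End Nodes.

End CantorGeometry.

(** * Two elementary inequalities *)

Lemma bernoulli_ineq (R : realFieldType) (x : R) n :
  -1 <= x -> 1 + n%:R * x <= (1 + x) ^+ n.
Proof.
move=> x1; elim: n => [|n IHn]; first by rewrite mul0r addr0 expr0.
have n0 : 0 <= n%:R :> R by exact: ler0n.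
have : (1 + x) * (1 + n%:R * x) <= (1 + x) * (1 + x) ^+ n by apply: ler_wpM2l; lra.
by rewrite -natr1 exprS; nra.
Qed.

Lemma sqrn_le_exp3 k : (k ^ 2 <= 3 ^ k)%N.
Proof.
elim: k => [//|[//|[//|k]] IHk]; rewrite expnS.
by apply: leq_trans (leq_mul (leqnn 3) IHk); lia.
Qed.

(** * The lengths of [K_alpha] and the choice of parameters *)

Section AlphaCantor.
Context {R : realType} (alpha ell1 : R).
Hypothesis alpha_gt2 : 2 < alpha.
Hypothesis ell1_gt0 : 0 < ell1.
Hypothesis ell1_le : ell1 <= 3^-1.
Hypothesis ell1_alpha : ell1 `^ (alpha - 1) <= 3^-1.

Local Notation ell := (ell_alpha alpha ell1).
Local Notation r := (cantor_ratio ell).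

Lemma alpha_ge1 : 1 <= alpha.
Proof. by apply: le_trans (ltW alpha_gt2); rewrite ler1n. Qed.

Lemma ell_alpha_gt0 s : 0 < ell s.
Proof. by case: s => [|s] //=; exact: powR_gt0. Qed.

Lemma ell_alpha_ratio s : r s.+1 = (ell1 `^ (alpha - 1)) `^ (alpha ^+ s).
Proof.
rewrite /cantor_ratio /= -powRrM -powRN -powRD; last by apply/implyP => _; rewrite gt_eqF.
by congr (_ `^ _); rewrite exprS; ring.
Qed.

Lemma ell_alpha_ratio_le s n : n%:R <= alpha ^+ s -> r s.+1 <= 3^-1 ^+ n.
Proof.
move=> ns; have third0 : 0 <= 3^-1 :> R by lra.
rewrite ell_alpha_ratio -[leRHS]powR_mulrn //.
apply: (@le_trans _ _ (3^-1 `^ (alpha ^+ s))).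
  have exp_ge0 : 0 <= alpha ^+ s by apply: le_trans ns.
  by apply: (ge0_ler_powR exp_ge0); rewrite ?nnegrE ?powR_ge0.
by apply: ger_powR => //; apply/andP; split; lra.
Qed.

Lemma ell_alpha_le s : 3 * ell s.+1 <= ell s.
Proof.
suff : r s <= 3^-1.
  by rewrite /cantor_ratio ler_pdivrMr ?ell_alpha_gt0 // => ?; lra.
case: s => [|s]; first by rewrite /cantor_ratio /= expr0 powRr1 ?divr1 // ltW.
by apply: (@ell_alpha_ratio_le s 1); rewrite exprn_ege1 // alpha_ge1.
Qed.

Lemma alpha_expn_le j k : (j <= k)%N -> (2 ^ j)%:R <= alpha ^+ k.
Proof.
move=> jk; rewrite natrX; apply: (@le_trans _ _ (alpha ^+ j)).
  by apply: lerXn2r; rewrite ?nnegrE ?ltW // (lt_trans _ alpha_gt2).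
by apply: ler_weXn2l => //; exact: alpha_ge1.
Qed.

(** Strictness of [2 < alpha] enters here: by Bernoulli, [(alpha / 2) ^+ t] grows at least linearly
    in [t]. *)
Lemma alpha_exp_dominates (c : nat) : exists b : nat, forall t, (b <= t)%N ->
  (c * 2 ^ t)%:R <= alpha ^+ t.
Proof.
have d0 : 0 < alpha / 2 - 1 by move: alpha_gt2; lra.
exists (Num.truncn (c%:R / (alpha / 2 - 1))).+1 => t bt.
have ct : c%:R <= t%:R * (alpha / 2 - 1).
  rewrite -ler_pdivrMr //; apply: le_trans (ltW (truncnS_gt _)) _.
  by rewrite ler_nat.
have -> : alpha ^+ t = (1 + (alpha / 2 - 1)) ^+ t * 2 ^+ t.
  by rewrite -exprMn; congr (_ ^+ _); field.
rewrite natrM natrX ler_pM2r ?exprn_gt0 //.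
by apply: le_trans (bernoulli_ineq t _); lra.
Qed.

Lemma K_alpha_lebesgue_unbounded (C : nat) : exists2 N : nat, (1 <= N)%N &
  forall z : 'I_N -> R, injective z -> (forall i, K_alpha alpha ell1 (z i)) ->
  exists2 x, K_alpha alpha ell1 x &
    C%:R <= \sum_(k < N) `|lagrange_basis z k x|.
Proof.
(* The 4 pays for [N.-1], since [N.+1 = 4 * 2 ^ (v + m)] below; the summand [C] leaves a surplus
   [3 ^+ C] in the skewed case. *)
have [b domb] := alpha_exp_dominates (4 + C).
(* With [m = C.+1], half of [(2 ^ m).-1] is still at least [C]. The size of [v] gives
   [6 * N <= (2 ^ v) ^ 2 <= 3 ^ (2 ^ v)], so [eps] is at most [1 / (6 * N)], and lets [domb] apply
   at [v + m]. *)
pose m := C.+1; pose v := (6 * 2 ^ m.+2 + b)%N; pose s := (v.+1 + m)%N.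
pose N := (2 ^ s.+1).-1; pose eps : R := 3^-1 ^+ (2 ^ v).
have N0 : (1 <= N)%N.
  by rewrite /N; have := ltn_expl s.+1 (ltnSn 1); lia.
exists N => // z z_inj Kz.
have eps0 : 0 < eps by rewrite exprn_gt0 // invr_gt0.
have epsN : eps * (6 * N%:R) <= 1.
  rewrite /eps exprVn ler_pdivrMl ?exprn_gt0 // mulr1 -natrM -natrX ler_nat.
  apply: leq_trans (sqrn_le_exp3 (2 ^ v)).
  have vle : (6 * 2 ^ m.+2 <= 2 ^ v)%N.
    by apply: leq_trans (ltnW (ltn_expl v (ltnSn 1))); exact: leq_addr.
  apply: (@leq_trans (6 * 2 ^ m.+2 * 2 ^ v)%N); last by rewrite -mulnn leq_mul2r vle orbT.
  rewrite -mulnA -expnD leq_mul2l /= /N /s.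
  by rewrite (_ : (v.+1 + m).+1 = m.+2 + v)%N ?leq_pred //; lia.
have N1 : 1 <= N%:R :> R by rewrite ler1n.
have eps3 : eps <= 3^-1 by nra.
have r_le j : (v.+1 <= j)%N -> r j <= eps.
  by case: j => // j vj; apply/ell_alpha_ratio_le/alpha_expn_le.
have us : (v.+1 <= s)%N by rewrite leq_addr.
have [x Kx xP] := lebesgue_function_ge (erefl : ell 0 = 1) ell_alpha_gt0
  ell_alpha_le Kz z_inj erefl us eps3 r_le.
exists x => //; case: xP; apply: le_trans.
  rewrite ler_pdivlMr; last by apply: cantor_ratio_gt0 => //; exact: ell_alpha_gt0.
  have /ell_alpha_ratio_le rs : (N.-1 + C)%:R <= alpha ^+ (v + m).
    apply: le_trans (domb (v + m)%N _); last by rewrite /v; lia.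
    rewrite ler_nat mulnDl leq_add //; last by rewrite leq_pmulr ?expn_gt0.
    rewrite /N /s (_ : (v.+1 + m).+1 = (v + m).+2)%N // !expnS; lia.
  apply: le_trans (ler_wpM2l (ler0n R C) rs) _.
  rewrite exprD mulrCA ler_piMr ?exprn_ge0 ?invr_ge0 // exprVn.
  rewrite ler_pdivrMr ?exprn_gt0 // mul1r -natrX ler_nat ltnW //.
  exact: ltn_expl.
have -> : (s - v.+1 = m)%N by rewrite /s addKn.
(* Bernoulli bounds the total loss by [3 * eps * N], which is at most 1/2. *)
have half : 2^-1 <= (1 - 3 * eps) ^+ N.-1.
  have eps1 : -1 <= - (3 * eps) by lra.
  apply: le_trans (bernoulli_ineq N.-1 eps1).
  have : N.-1%:R <= N%:R :> R by rewrite ler_nat leq_pred.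
  by nra.
have Cm : C%:R <= (2 ^ m).-1%:R * 2^-1 :> R.
  rewrite ler_pdivlMr // -natrM ler_nat /m expnS.
  by have := ltn_expl C (ltnSn 1); lia.
apply: le_trans Cm _.
by apply: ler_wpM2l.
Qed.

End AlphaCantor.

Theorem theorem5p1 (R : realType) (alpha ell1 : R)
    (halpha : 2 < alpha)
    (hell1_gt0 : 0 < ell1)
    (hell1_le : ell1 <= 3^-1)
    (hell1_alpha : ell1 `^ (alpha - 1) <= 3^-1) :
  ~ BLC (K_alpha alpha ell1).
Proof.
case=> X [XP [M XM]].
have [N N1 NP] := K_alpha_lebesgue_unbounded halpha hell1_gt0 hell1_le
  hell1_alpha (Num.truncn M).+1.
have [X_inj KX] := XP N N1; have [x Kx] := NP _ X_inj KX.
apply/negP; rewrite -ltNge; apply: le_lt_trans (truncnS_gt M).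
rewrite -lee_fin; apply: le_trans (XM N N1).
by apply: ereal_sup_ubound; exists x.
Qed.
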